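(* Let $L$ be a nilpotent diassociative algebra of class $n$ over a field $\mathbb{F}$. Then the sequence $$\mathcal{H}^2(L/L^n,\mathbb{F})\xrightarrow{\ \mathrm{Inf}\ }\mathcal{H}^2(L,\mathbb{F})\xrightarrow{\ \delta\ }(L/Z_{n-1}\otimes L^n\oplus L^n\otimes L/Z_{n-1})^2$$ is exact, where $\mathrm{Inf}$ and $\delta$ are the maps described in the context.
   Context: A diassociative algebra $L$ over a field $\mathbb{F}$ is an $\mathbb{F}$-vector space with two associative bilinear products $\dashv,\vdash$ satisfying $x\dashv(y\dashv z)=x\dashv(y\vdash z)$, $(x\vdash y)\dashv z=x\vdash(y\dashv z)$, $(x\dashv y)\vdash z=(x\vdash y)\vdash z$ for all $x,y,z\in L$. The center $Z(L)$ is the set of $z\in L$ with $z\dashv x=z\vdash x=x\dashv z=x\vdash z=0$ for all $x\in L$. For subalgebras $X,Y$ of $L$, $X\lozenge Y=X\dashv Y+X\vdash Y$, where $X\dashv Y$ and $X\vdash Y$ are the spans of the corresponding products. The lower central series is $L^1=L$, $L^{k+1}=L^1\lozenge L^k+L^2\lozenge L^{k-1}+\cdots+L^k\lozenge L^1$. $L$ is nilpotent of class $n$ ($n\ge 1$) if $L^n\neq 0$ and $L^{n+1}=0$. The upper central series is $Z_0=0$, $Z_1=Z(L)$, $Z_{j+1}=\{x\in L\mid \forall l\in L,\ x\dashv l,\ x\vdash l,\ l\dashv x,\ l\vdash x\in Z_j\}$ for $j\ge1$. For a diassociative algebra $Q$ over $\mathbb{F}$, $\mathcal{Z}^2(Q,\mathbb{F})$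 is the space of pairs $(f_{\dashv},f_{\vdash})$ of bilinear forms $Q\times Q\to\mathbb{F}$ such that for all $i,j,k\in Q$: $f_{\dashv}(i,j\dashv k)=f_{\dashv}(i,j\vdash k)$; $f_{\dashv}(i\vdash j,k)=f_{\vdash}(i,j\dashv k)$; $f_{\vdash}(i\dashv j,k)=f_{\vdash}(i\vdash j,k)$; $f_{\dashv}(i,j\dashv k)=f_{\dashv}(i\dashv j,k)$; $f_{\vdash}(i,j\vdash k)=f_{\vdash}(i\vdash j,k)$. $\mathcal{B}^2(Q,\mathbb{F})$ is the subspace of pairs for which there is a linear map $\varepsilon:Q\to\mathbb{F}$ with $f_{\dashv}(x,y)=-\varepsilon(x\dashv y)$ and $f_{\vdash}(x,y)=-\varepsilon(x\vdash y)$ for all $x,y$; and $\mathcal{H}^2(Q,\mathbb{F})=\mathcal{Z}^2(Q,\mathbb{F})/\mathcal{B}^2(Q,\mathbb{F})$. The map $\mathrm{Inf}$ sends the class of $(f_{\dashv},f_{\vdash})$ to the class of $(f'_{\dashv},f'_{\vdash})$, where $f'_{\dashv}(x,y)=f_{\dashv}(x+L^n,y+L^n)$ and $f'_{\vdash}(x,y)=f_{\vdash}(x+L^n,y+L^n)$. $(X\otimes Y\oplus Y\otimes X)^2$ denotes $(X\otimes Y\oplus Y\otimes X)\oplus(X\otimes Y\oplus Y\otimes X)$; as the target of $\delta$, its elements are understood as quadruples $(f_1,g_1,f_2,g_2)$ of bilinear forms $f_1,f_2:X\times Y\to\mathbb{F}$ and $g_1,g_2:Y\times X\to\mathbb{F}$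 (for finite-dimensional $X,Y$ this space of quadruples is isomorphic to the direct sum of tensor products). The linear map $\delta$ sends the class of $(f'_{\dashv},f'_{\vdash})\in\mathcal{Z}^2(L,\mathbb{F})$ to $(f''_{\dashv},g''_{\dashv},f''_{\vdash},g''_{\vdash})$, where for $x\in L$, $b\in L^n$: $f''_{\dashv}(x+Z_{n-1},b)=f'_{\dashv}(x,b)$, $g''_{\dashv}(b,x+Z_{n-1})=f'_{\dashv}(b,x)$, $f''_{\vdash}(x+Z_{n-1},b)=f'_{\vdash}(x,b)$, $g''_{\vdash}(b,x+Z_{n-1})=f'_{\vdash}(b,x)$. (That $\delta$ is well defined is part of what is asserted.) *)

(* Defs.v *)
From HB Require Import structures.
From mathcomp Require Import all_boot all_algebra.
From mathcomp Require Import boolp classical_sets functions.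

Set Implicit Arguments.
Unset Strict Implicit.
Unset Printing Implicit Defensive.

Import GRing.Theory.

Local Open Scope ring_scope.
Local Open Scope classical_set_scope.
Local Open Scope quotient_scope.

Reserved Notation "x ⊣ y" (at level 40, left associativity).
Reserved Notation "x ⊢ y" (at level 40, left associativity).
Reserved Notation "X ◊ Y" (at level 40, left associativity).

Section Subspaces.
Variables (F : fieldType) (V : lmodType F).

Definition is_subspace (A : set V) : Prop :=
  A 0 /\ forall (a : F) x y, A x -> A y -> A (a *: x + y).

Definition lin_span (A : set V) : set V := smallest is_subspace A.

Definition sum_set (A B : set V) : set V := [set x + y | x in A & y in B].

Lemma sum_setA : associative sum_set.
Proof.
move=> A B C; apply/seteqP; split.
- move=> _ [x Ax [_ [y By [z Cz <-]] <-]]; rewrite addrA.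
  by exists (x + y); [exists x => //; exists y|exists z].
- move=> _ [_ [x Ax [y By <-]] [z Cz <-]]; rewrite -addrA.
  by exists x => //; exists (y + z) => //; exists y => //; exists z.
Qed.

Lemma sum_setC : commutative sum_set.
Proof.
by move=> A B; apply/seteqP; split=> _ [x Ax [y By <-]]; exists y => //;
  exists x => //; rewrite addrC.
Qed.

Lemma sum_set0 : left_id [set 0] sum_set.
Proof.
move=> A; apply/seteqP; split=> [_ [_ -> [y Ay <-]]|x Ax]; first by rewrite add0r.
by exists 0 => //; exists x => //; rewrite add0r.
Qed.

HB.instance Definition _ := Monoid.isComLaw.Build (set V) [set 0] sum_set
  sum_setA sum_setC sum_set0.

Record subspace := Subspace {
  subspace_set :> set V;
  subspaceP : is_subspace subspace_set }.

Lemma lin_span_subspace (A : set V) : is_subspace (lin_span A).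
Proof.
split=> [B [[]]//|a x y Ax Ay B BA].
by apply: (BA.1.2); [exact: Ax|exact: Ay].
Qed.

Lemma sum_subspace (A B : set V) :
  is_subspace A -> is_subspace B -> is_subspace (sum_set A B).
Proof.
move=> [A0 Al] [B0 Bl]; split=> [|a _ _ [x Ax [y By <-]] [x' Ax' [y' By' <-]]].
  by exists 0 => //; exists 0 => //; rewrite addr0.
exists (a *: x + x'); first exact: Al.
by exists (a *: y + y'); [exact: Bl|rewrite scalerDr addrACA].
Qed.

End Subspaces.

Section SubspaceType.
Variables (F : fieldType) (V : lmodType F) (U : subspace V).

Definition subspace_pred : {pred V} := fun x => x \in (U : set V).

Lemma subspace_predP x : reflect (subspace_set U x) (x \in subspace_pred).
Proof. by apply: (iffP idP); rewrite unfold_in in_setE. Qed.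

Let subspace_submod : submod_closed subspace_pred.
Proof.
have [U0 Ul] := subspaceP U.
split=> [|a x y /subspace_predP Ux /subspace_predP Uy]; apply/subspace_predP => //.
exact: Ul.
Qed.

HB.instance Definition _ := GRing.isSubmodClosed.Build F V subspace_pred
  (GRing.submod_closed_semi subspace_submod).

Definition sub_space : Type := {x : V | x \in subspace_pred}.
HB.instance Definition _ := SubChoice.on sub_space.
HB.instance Definition _ := [SubChoice_isSubLmodule of sub_space by <:].

Definition quot_space : Type := Quotient.quot subspace_pred.
HB.instance Definition _ := EqQuotient.on quot_space.
HB.instance Definition _ := GRing.Zmodule.on quot_space.

Definition qproj (x : V) : quot_space := \pi x.

Lemma qproj_eq (x y : V) : (qproj x = qproj y) <-> subspace_set U (x - y).
Proof.
split=> [/eqP|Uxy]; first by rewrite -Quotient.idealrBE => /subspace_predP.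
by apply/eqP; rewrite -Quotient.idealrBE; exact/subspace_predP.
Qed.

Lemma qproj_surj (q : quot_space) : exists x, q = qproj x.
Proof. by exists (repr q); rewrite /qproj reprK. Qed.

Let qprojB : {morph qproj : x y / x - y}.
Proof. by move=> x y; exact: (raddfB \pi_(Quotient.quot subspace_pred)). Qed.

Let qprojD : {morph qproj : x y / x + y}.
Proof. by move=> x y; exact: (raddfD \pi_(Quotient.quot subspace_pred)). Qed.

Let qscale (a : F) (q : quot_space) : quot_space := qproj (a *: repr q).

Let qscale_proj a x : qscale a (qproj x) = qproj (a *: x).
Proof.
apply/qproj_eq; rewrite -scalerBr -[_ *: _]addr0.
have [U0 Ul] := subspaceP U; apply: Ul => //; apply/qproj_eq.
by rewrite /qproj reprK.
Qed.

Let qscaleA a b q : qscale a (qscale b q) = qscale (a * b) q.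
Proof.
by have [x ->] := qproj_surj q; rewrite !qscale_proj scalerA.
Qed.

Let qscale1 : left_id 1 qscale.
Proof. by move=> q; have [x ->] := qproj_surj q; rewrite qscale_proj scale1r. Qed.

Let qscaleDr : right_distributive qscale +%R.
Proof.
move=> a p q; have [x ->] := qproj_surj p; have [y ->] := qproj_surj q.
by rewrite -qprojD !qscale_proj scalerDr qprojD.
Qed.

Let qscaleDl q : {morph qscale^~ q : a b / a + b}.
Proof.
by move=> a b; have [x ->] := qproj_surj q; rewrite !qscale_proj scalerDl qprojD.
Qed.

HB.instance Definition _ := GRing.Zmodule_isLmodule.Build F quot_space
  qscaleA qscale1 qscaleDr qscaleDl.

Let qproj_linear : linear qproj.
Proof. by move=> a x y; rewrite qprojD -qscale_proj. Qed.

HB.instance Definition _ :=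
  GRing.isLinear.Build F V quot_space _ qproj qproj_linear.

End SubspaceType.

Arguments qproj {F V} U x.

Section BilinearForms.
Variables (F : fieldType) (X Y : lmodType F).

Definition bilin_set : set (X -> Y -> F^o) := [set f | bilinear_for *%R *%R f].

Let bilin_is_subspace : is_subspace bilin_set.
Proof.
have E0 x y : (0 : X -> Y -> F^o) x y = 0 :> F by [].
have E a (f g : X -> Y -> F^o) x y : (a *: f + g) x y = a * f x y + g x y :> F by [].
split=> [|a f g [fl fr] [gl gr]]; split=> u k x y; rewrite ?(E0, E) /=.
- by rewrite mulr0 addr0.
- by rewrite mulr0 addr0.
- by rewrite fl gl !mulrDr addrACA mulrCA.
- by rewrite fr gr !mulrDr addrACA mulrCA.
Qed.

Definition bilin_subspace := Subspace bilin_is_subspace.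

Definition bilform := sub_space bilin_subspace.
HB.instance Definition _ := GRing.Lmodule.on bilform.

Definition bilform_fun (f : bilform) : X -> Y -> F := val f.

Lemma bilformP (f : bilform) : bilinear_for *%R *%R (bilform_fun f).
Proof. by move: (valP f) => /subspace_predP. Qed.

Definition Bilform (f : X -> Y -> F) (fP : bilinear_for *%R *%R f) : bilform :=
  exist _ f (introT (subspace_predP bilin_subspace f) fP).

End BilinearForms.

Coercion bilform_fun : bilform >-> Funclass.

Lemma bilformE (F : fieldType) (X Y : lmodType F) (a : F) (f g : bilform X Y) x y :
  bilform_fun (a *: f + g) x y = a * f x y + g x y.
Proof. by rewrite /bilform_fun (linearP \val). Qed.

Lemma bilform_ext (F : fieldType) (X Y : lmodType F) (f g : bilform X Y) :
  (forall x y, f x y = g x y) -> f = g.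
Proof. by move=> fg; apply/val_inj/funext => x; apply/funext => y; exact: fg. Qed.

HB.mixin Record Lmodule_isDiass (F : fieldType) L of GRing.Lmodule F L := {
  dil : L -> L -> L;
  dir : L -> L -> L;
  dil_bilinear : bilinear_for *:%R *:%R dil;
  dir_bilinear : bilinear_for *:%R *:%R dir;
  dilA : associative dil;
  dirA : associative dir;
  dil_dilr : forall x y z, dil x (dil y z) = dil x (dir y z);
  dil_dir : forall x y z, dil (dir x y) z = dir x (dil y z);
  dir_dirl : forall x y z, dir (dil x y) z = dir (dir x y) z
}.

#[short(type="diassType")]
HB.structure Definition Diass (F : fieldType) :=
  {L of GRing.Lmodule F L & Lmodule_isDiass F L}.

Notation "x ⊣ y" := (dil x y) : ring_scope.
Notation "x ⊢ y" := (dir x y) : ring_scope.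

Section Ideals.
Variables (F : fieldType) (L : diassType F).

Definition is_ideal (A : set L) : Prop :=
  is_subspace A /\
  forall x y, A y -> [/\ A (x ⊣ y), A (x ⊢ y), A (y ⊣ x) & A (y ⊢ x)].

Record ideal := Ideal {
  ideal_subspace :> subspace L;
  idealP : is_ideal ideal_subspace }.

End Ideals.

Section QuotientAlgebra.
Variables (F : fieldType) (L : diassType F) (I : ideal L).

Definition quot_alg : Type := quot_space I.
HB.instance Definition _ := GRing.Lmodule.on quot_alg.

Let p (x : L) : quot_alg := qproj I x.

Let p_surj q : exists x, q = p x. Proof. exact: qproj_surj. Qed.

Let p_lin : linear p. Proof. exact: linearP. Qed.

Let ql (q r : quot_alg) : quot_alg := p (repr q ⊣ repr r).
Let qr (q r : quot_alg) : quot_alg := p (repr q ⊢ repr r).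

Let congr_p (op : L -> L -> L) : bilinear_for *:%R *:%R op ->
    (forall x y, subspace_set I y -> subspace_set I (op x y) /\ subspace_set I (op y x)) ->
  forall x y x' y', p x = p x' -> p y = p y' -> p (op x y) = p (op x' y').
Proof.
move=> [opl opr] Iop x y x' y' /qproj_eq xx' /qproj_eq yy'; apply/qproj_eq.
have [I0 Il] := subspaceP I.
have /= /(_ y) := opl _ 1 (x - x') x'; rewrite !scale1r subrK => ->.
have /= := opr x' 1 (y - y') y'; rewrite !scale1r subrK => ->.
rewrite addrA addrK -[X in subspace_set I X]addrC -[op x' _]scale1r.
by apply: Il; [exact: (Iop _ _ yy').1|exact: (Iop _ _ xx').2].
Qed.

Let reprp x : p (repr (p x)) = p x. Proof. exact: reprK. Qed.

Let ql_p x y : ql (p x) (p y) = p (x ⊣ y).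
Proof.
apply: congr_p => //; first exact: dil_bilinear.
by move=> a b Ib; have [_ /(_ a b Ib)[]] := idealP I.
Qed.

Let qr_p x y : qr (p x) (p y) = p (x ⊢ y).
Proof.
apply: congr_p => //; first exact: dir_bilinear.
by move=> a b Ib; have [_ /(_ a b Ib)[]] := idealP I.
Qed.

Let ql_bilinear : bilinear_for *:%R *:%R ql.
Proof.
split=> u k x y; have [{u}u ->] := p_surj u; have [{x}x ->] := p_surj x;
  have [{y}y ->] := p_surj y; rewrite -p_lin !ql_p -p_lin; congr p.
- by have [H _] := @dil_bilinear F L; exact: H.
- by have [_ H] := @dil_bilinear F L; exact: H.
Qed.

Let qr_bilinear : bilinear_for *:%R *:%R qr.
Proof.
split=> u k x y; have [{u}u ->] := p_surj u; have [{x}x ->] := p_surj x;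
  have [{y}y ->] := p_surj y; rewrite -p_lin !qr_p -p_lin; congr p.
- by have [H _] := @dir_bilinear F L; exact: H.
- by have [_ H] := @dir_bilinear F L; exact: H.
Qed.

Let qlA : associative ql.
Proof.
move=> x y z; have [{x}x ->] := p_surj x; have [{y}y ->] := p_surj y.
by have [{z}z ->] := p_surj z; rewrite !ql_p dilA.
Qed.

Let qrA : associative qr.
Proof.
move=> x y z; have [{x}x ->] := p_surj x; have [{y}y ->] := p_surj y.
by have [{z}z ->] := p_surj z; rewrite !qr_p dirA.
Qed.

Let ql_qlr x y z : ql x (ql y z) = ql x (qr y z).
Proof.
have [{x}x ->] := p_surj x; have [{y}y ->] := p_surj y.
by have [{z}z ->] := p_surj z; rewrite qr_p !ql_p dil_dilr.
Qed.

Let ql_qr x y z : ql (qr x y) z = qr x (ql y z).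
Proof.
have [{x}x ->] := p_surj x; have [{y}y ->] := p_surj y.
by have [{z}z ->] := p_surj z; rewrite qr_p !ql_p qr_p dil_dir.
Qed.

Let qr_qrl x y z : qr (ql x y) z = qr (qr x y) z.
Proof.
have [{x}x ->] := p_surj x; have [{y}y ->] := p_surj y.
by have [{z}z ->] := p_surj z; rewrite ql_p !qr_p dir_dirl.
Qed.

HB.instance Definition _ := Lmodule_isDiass.Build F quot_alg
  ql_bilinear qr_bilinear qlA qrA ql_qlr ql_qr qr_qrl.

Definition qalg (x : L) : quot_alg := qproj I x.
HB.instance Definition _ := GRing.isLinear.Build F L quot_alg _ qalg p_lin.

Lemma qalg_dil x y : qalg (x ⊣ y) = qalg x ⊣ qalg y.
Proof. exact/esym/ql_p. Qed.

Lemma qalg_dir x y : qalg (x ⊢ y) = qalg x ⊢ qalg y.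
Proof. exact/esym/qr_p. Qed.

End QuotientAlgebra.

Arguments qalg {F L} I x.

Section Series.
Variables (F : fieldType) (L : diassType F).
Implicit Types X Y : set L.

Definition dil_set X Y : set L := lin_span [set x ⊣ y | x in X & y in Y].
Definition dir_set X Y : set L := lin_span [set x ⊢ y | x in X & y in Y].
Definition lozenge X Y : set L := sum_set (dil_set X Y) (dir_set X Y).
Local Notation "X ◊ Y" := (lozenge X Y).

(* Course-of-values recursion: [lcs_upto k m] is L^m for 1 <= m <= k.+1, and
   the junk value L for m = 0. *)
Fixpoint lcs_upto (k : nat) : nat -> set L :=
  if k is k'.+1 then
    fun m => if (m <= k)%N then lcs_upto k' m
             else \big[@sum_set F L/[set 0]]_(1 <= i < k.+1)
                    (lcs_upto k' i ◊ lcs_upto k' (k.+1 - i))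
  else fun=> setT.

Definition lcs (m : nat) : set L := lcs_upto m.-1 m.

Lemma lcs1 : lcs 1 = setT. Proof. by []. Qed.

Let lcs_uptoE k m : (m <= k.+1)%N -> lcs_upto k m = lcs m.
Proof.
elim: k => [|k IHk]; first by case: m => [|[]].
rewrite leq_eqVlt => /predU1P[->//|]; rewrite ltnS => mk /=.
by rewrite mk IHk.
Qed.

Lemma lcsS k :
  lcs k.+2 = \big[@sum_set F L/[set 0]]_(1 <= i < k.+2) (lcs i ◊ lcs (k.+2 - i)).
Proof.
rewrite {1}/lcs [lcs_upto _ _]/= ltnn.
rewrite !big_nat; apply: eq_bigr => i /andP[i1 ik].
by rewrite !lcs_uptoE// leq_subLR -[X in (X <= _)%N]add1n leq_add2r.
Qed.

Definition center : set L :=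
  [set z | forall x, [/\ z ⊣ x = 0, z ⊢ x = 0, x ⊣ z = 0 & x ⊢ z = 0]].

Fixpoint ucs (j : nat) : set L :=
  match j with
  | 0 => [set 0]
  | 1 => center
  | (_.+1 as i).+1 => [set x | forall l,
      [/\ ucs i (x ⊣ l), ucs i (x ⊢ l), ucs i (l ⊣ x) & ucs i (l ⊢ x)]]
  end.

Lemma ucsS j : ucs j.+1 = [set x | forall l,
  [/\ ucs j (x ⊣ l), ucs j (x ⊢ l), ucs j (l ⊣ x) & ucs j (l ⊢ x)]].
Proof. by case: j. Qed.

Lemma lozenge_subspace X Y : is_subspace (X ◊ Y).
Proof. by apply: sum_subspace; exact: lin_span_subspace. Qed.

Lemma lozengeS X X' Y Y' : X `<=` X' -> Y `<=` Y' -> X ◊ Y `<=` X' ◊ Y'.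
Proof.
have spanS (A A' : set L) : A `<=` A' -> lin_span A `<=` lin_span A'.
  by move=> AA' x Ax B [sB A'B]; apply: Ax; split => // y /AA' /A'B.
move=> XX' YY' _ [x Xx [y Yy <-]]; exists x; last (exists y => //).
- by apply: spanS Xx => _ [u Xu [v Yv <-]]; exists u; [exact: XX'|exists v; auto].
- by apply: spanS Yy => _ [u Xu [v Yv <-]]; exists u; [exact: XX'|exists v; auto].
Qed.

Lemma lcs_is_subspace k : is_subspace (lcs k).
Proof.
case: k => [|[|k]]; [by []|by []|rewrite lcsS].
elim/big_ind: _ => [|A B|i _]; last exact: lozenge_subspace.
- by split=> [//|a _ _ -> ->]; rewrite /= scaler0 addr0.
- exact: sum_subspace.
Qed.

Lemma lozenge_lcs i j : (0 < i)%N -> (0 < j)%N -> lcs i ◊ lcs j `<=` lcs (i + j).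
Proof.
case: i j => [//|i] [//|j] _ _ x ijx; rewrite addSnnS addnC addSn addSn lcsS.
have ir : i.+1 \in index_iota 1 (j + i).+2.
  by rewrite mem_index_iota /= ltnS ltnS leq_addl.
rewrite (bigD1_seq i.+1) ?iota_uniq //=; exists x.
  by rewrite -addnS -addSn addnK.
exists 0; last by rewrite addr0.
elim/big_ind: _ => // [A B A0 B0|k _]; last exact: (lozenge_subspace _ _).1.
by exists 0 => //; exists 0 => //; rewrite addr0.
Qed.

Lemma lcs_decr k : lcs k.+1 `<=` lcs k.
Proof.
case: k => [//|k]; elim/ltn_ind: k => -[_ //|k IHk].
have [_ lcsl] := lcs_is_subspace k.+2.
rewrite [X in X `<=` _]lcsS big_nat.
elim/big_ind: _ => [_ ->|A B sA sB _ [x Ax [y By <-]]|[//|[|i]] /andP[_ ik]].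
- exact: (lcs_is_subspace _).1.
- by rewrite -[x]scale1r; apply: lcsl; [exact: sA|exact: sB].
- rewrite subn1 /=; apply: subset_trans (@lozenge_lcs 1 k.+1 _ _) => //.
  by apply: lozengeS => //; exact: IHk.
- rewrite subSS; apply: (@subset_trans _ (lcs i.+1 ◊ lcs (k.+2 - i.+1))).
    by apply: lozengeS => //; apply: IHk; rewrite -ltnS.
  have {2}-> : (k.+2 = i.+1 + (k.+2 - i.+1))%N by rewrite subnKC // ltnW.
  by apply: lozenge_lcs; rewrite // subn_gt0.
Qed.

Lemma lcs_is_ideal k : is_ideal (lcs k).
Proof.
split=> [|x y ky]; first exact: lcs_is_subspace.
case: k ky => [//|k] ky.
have l1 : lcs 1 ◊ lcs k.+1 `<=` lcs k.+1.
  by apply: subset_trans (@lcs_decr _); exact: (@lozenge_lcs 1 k.+1).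
have r1 : lcs k.+1 ◊ lcs 1 `<=` lcs k.+1.
  by apply: subset_trans (@lcs_decr _); rewrite -[k.+2]addn1; exact: lozenge_lcs.
have sl A B u v : A u -> B v -> (A ◊ B) (u ⊣ v).
  move=> Au Bv; exists (u ⊣ v); first by apply: sub_gen_smallest; exists u => //; exists v.
  by exists 0; [exact: (lin_span_subspace _).1|rewrite addr0].
have sr A B u v : A u -> B v -> (A ◊ B) (u ⊢ v).
  move=> Au Bv; exists 0; first exact: (lin_span_subspace _).1.
  by exists (u ⊢ v); [apply: sub_gen_smallest; exists u => //; exists v|rewrite add0r].
by split; [apply/l1/sl|apply/l1/sr|apply/r1/sl|apply/r1/sr].
Qed.

Definition lcs_ideal (k : nat) : ideal L :=
  @Ideal F L (Subspace (lcs_is_subspace k)) (lcs_is_ideal k).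

Lemma ucs_is_subspace j : is_subspace (ucs j).
Proof.
elim: j => [|j [j0 jl]].
  by split=> [//|a _ _ -> ->]; rewrite /= scaler0 addr0.
have [ll lr] := @dil_bilinear F L; have [rl rr] := @dir_bilinear F L.
have l0 (x : L) : x ⊣ 0 = 0 /\ 0 ⊣ x = 0.
  have /= := lr x (-1) 0 0; have /= := ll x (-1) 0 0.
  by rewrite scaler0 addr0 !scaleN1r !addNr.
have r0 (x : L) : x ⊢ 0 = 0 /\ 0 ⊢ x = 0.
  have /= := rr x (-1) 0 0; have /= := rl x (-1) 0 0.
  by rewrite scaler0 addr0 !scaleN1r !addNr.
rewrite ucsS; split=> [l|a x y xj yj l].
  by rewrite (l0 l).1 (l0 l).2 (r0 l).1 (r0 l).2.
have [x1 x2 x3 x4] := xj l; have [y1 y2 y3 y4] := yj l.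
by split; [rewrite ll|rewrite rl|rewrite lr|rewrite rr]; exact: jl.
Qed.

Definition ucs_subspace (j : nat) : subspace L := Subspace (ucs_is_subspace j).

Definition nilpotent_of_class (n : nat) : Prop :=
  [/\ (0 < n)%N, lcs n <> [set 0] & lcs n.+1 = [set 0]].

End Series.

Section Cohomology.
Variables (F : fieldType) (Q : diassType F).

(* A pair (f_⊣, f_⊢), read as [f.1] and [f.2]. *)
Definition cochain : Type := (bilform Q Q * bilform Q Q)%type.
HB.instance Definition _ := GRing.Lmodule.on cochain.

Definition is_cocycle (f : cochain) : Prop :=
  forall i j k : Q,
    [/\ f.1 i (j ⊣ k) = f.1 i (j ⊢ k),
        f.1 (i ⊢ j) k = f.2 i (j ⊣ k),
        f.2 (i ⊣ j) k = f.2 (i ⊢ j) k,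
        f.1 i (j ⊣ k) = f.1 (i ⊣ j) k &
        f.2 i (j ⊢ k) = f.2 (i ⊢ j) k].

Definition is_coboundary (f : cochain) : Prop :=
  exists e : {scalar Q},
    forall x y, f.1 x y = - e (x ⊣ y) /\ f.2 x y = - e (x ⊢ y).

Lemma coboundary_cocycle f : is_coboundary f -> is_cocycle f.
Proof.
move=> [e fe] i j k; rewrite !(fe _ _).1 !(fe _ _).2.
split.
- by rewrite dil_dilr.
- by rewrite dil_dir.
- by rewrite dir_dirl.
- by rewrite dilA.
- by rewrite dirA.
Qed.

Let cocycle_subspace : is_subspace [set f | is_cocycle f].
Proof.
split=> [i j k|a f g fc gc i j k]; first by split.
have [f1 f2 f3 f4 f5] := fc i j k; have [g1 g2 g3 g4 g5] := gc i j k.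
have E1 x y : (a *: f + g).1 x y = a * f.1 x y + g.1 x y := bilformE _ _ _ _ _.
have E2 x y : (a *: f + g).2 x y = a * f.2 x y + g.2 x y := bilformE _ _ _ _ _.
by rewrite !E1 !E2 f1 f2 f3 -f4 f5 f1 g1 g2 g3 -g4 g5 g1.
Qed.

Definition Z2_subspace := Subspace cocycle_subspace.
Definition Z2 := sub_space Z2_subspace.
HB.instance Definition _ := GRing.Lmodule.on Z2.

Definition cocycle (z : Z2) : cochain := val z.
Definition Cocycle (f : cochain) (fP : is_cocycle f) : Z2 :=
  exist _ f (introT (subspace_predP Z2_subspace f) fP).

Lemma cocycleP (z : Z2) : is_cocycle (cocycle z).
Proof. by move: (valP z) => /subspace_predP. Qed.

Lemma cocycle_linear a (f g : Z2) :
  cocycle (a *: f + g) = a *: cocycle f + cocycle g.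
Proof. exact: (linearP \val). Qed.

Let coboundary_subspace : is_subspace [set z | is_coboundary (cocycle z)].
Proof.
split=> [|a f g [d fd] [e ge]].
  by exists \0 => x y /=; rewrite oppr0.
have hlin : scalar (fun x => a * d x + e x).
  by move=> k x y; rewrite !linearP /= !mulrDr addrACA mulrCA.
pose h : {scalar Q} := HB.pack (fun x => a * d x + e x)
  (GRing.isLinear.Build F Q F *%R (fun x => a * d x + e x) hlin).
exists h => x y; rewrite cocycle_linear; split.
- by rewrite [LHS]bilformE (fd x y).1 (ge x y).1 mulrN -opprD.
- by rewrite [LHS]bilformE (fd x y).2 (ge x y).2 mulrN -opprD.
Qed.

(* B^2 as a subspace of the type Z2; nothing is lost, by
   [coboundary_cocycle]. *)
Definition B2_subspace := Subspace coboundary_subspace.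

Definition H2 := quot_space B2_subspace.
HB.instance Definition _ := GRing.Lmodule.on H2.

Definition cohom_class (z : Z2) : H2 := qproj B2_subspace z.

Lemma cohom_class_eq (f g : Z2) :
  cohom_class f = cohom_class g <-> is_coboundary (cocycle (f - g)).
Proof. exact: qproj_eq. Qed.

End Cohomology.

Section Inflation.
Variables (F : fieldType) (L : diassType F) (I : ideal L).

Let infl_form (f : bilform (quot_alg I) (quot_alg I)) (x y : L) : F :=
  f (qalg I x) (qalg I y).

Let infl_bilinear f : bilinear_for *%R *%R (infl_form f).
Proof.
have [fl fr] := bilformP f.
by split=> u k x y /=; rewrite /infl_form linearP ?fl ?fr.
Qed.

Let infl_cochain (f : cochain (quot_alg I)) : cochain L :=
  (Bilform (infl_bilinear f.1), Bilform (infl_bilinear f.2)).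

Let infl_cocycle (z : Z2 (quot_alg I)) : is_cocycle (infl_cochain (cocycle z)).
Proof.
move=> i j k; rewrite /= /bilform_fun /= /infl_form !qalg_dil !qalg_dir.
exact: (cocycleP z).
Qed.

Definition infl (z : Z2 (quot_alg I)) : Z2 L := Cocycle (infl_cocycle z).

Lemma inflE z x y :
  (cocycle (infl z)).1 x y = (cocycle z).1 (qalg I x) (qalg I y) /\
  (cocycle (infl z)).2 x y = (cocycle z).2 (qalg I x) (qalg I y).
Proof. by []. Qed.

Lemma infl_linear : linear infl.
Proof.
move=> a f g; apply/val_inj; rewrite -!/(cocycle _) cocycle_linear.
apply/eqP; rewrite -pair_eqE; apply/andP; split; apply/eqP/bilform_ext => x y.
- rewrite [RHS]bilformE (inflE _ x y).1 (inflE f x y).1 (inflE g x y).1.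
  by rewrite cocycle_linear [LHS]bilformE.
- rewrite [RHS]bilformE (inflE _ x y).2 (inflE f x y).2 (inflE g x y).2.
  by rewrite cocycle_linear [LHS]bilformE.
Qed.

HB.instance Definition _ := GRing.isLinear.Build F _ _ _ infl infl_linear.

(* Independent of the representative: see [Inf_cohom_class]. *)
Definition Inf (h : H2 (quot_alg I)) : H2 L := cohom_class (infl (repr h)).

Lemma Inf_cohom_class z : Inf (cohom_class z) = cohom_class (infl z).
Proof.
have /cohom_class_eq[e ez] : cohom_class (repr (cohom_class z)) = cohom_class z.
  by rewrite /cohom_class /qproj reprK.
apply/cohom_class_eq; rewrite -raddfB.
have elin : scalar (fun x => e (qalg I x)) by move=> a x y; rewrite !linearP.
pose d : {scalar L} := HB.pack (fun x => e (qalg I x))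
  (GRing.isLinear.Build F L F *%R (fun x => e (qalg I x)) elin).
have dE u : d u = e (qalg I u) by [].
exists d => x y; rewrite (inflE _ x y).1 (inflE _ x y).2 !dE qalg_dil qalg_dir.
exact: ez.
Qed.

Lemma Inf_linear : linear Inf.
Proof.
move=> a h k; have [z ->] := qproj_surj h; have [t ->] := qproj_surj k.
rewrite -!/(cohom_class _) !Inf_cohom_class.
rewrite [in LHS]/cohom_class -[in LHS](linearP (qproj (B2_subspace _))) -/(cohom_class _).
by rewrite Inf_cohom_class infl_linear; exact: (linearP (qproj (B2_subspace _))).
Qed.

HB.instance Definition _ := GRing.isLinear.Build F _ _ _ Inf Inf_linear.

End Inflation.

(* Quadruples ((f1, g1), (f2, g2)), standing for (X ⊗ Y ⊕ Y ⊗ X)^2. *)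
Definition bilform_quad (F : fieldType) (X Y : lmodType F) : Type :=
  ((bilform X Y * bilform Y X) * (bilform X Y * bilform Y X))%type.
HB.instance Definition _ (F : fieldType) (X Y : lmodType F) :=
  GRing.Lmodule.on (bilform_quad X Y).

(* Main.v *)
Require Import Defs.
From mathcomp Require Import all_boot all_algebra.
From HB Require Import structures.
From mathcomp Require Import boolp classical_sets.

(** The central fact is that a cocycle [f] on any diassociative algebra satisfies
    [f(Z_j, L^{j+1}) = f(L^{j+1}, Z_j) = 0] for both of its components
    ([cocycle_ucs_lcs]).  Indeed [L^{j+1}] is spanned by the products of
    [u] in [L^i] and [v] in [L^{j+1-i}] with [1 <= i <= j], and the
    cocycle identities move one of these factors across: for instance
    [f(z, u ⊣ v) = f(z ⊣ u, v)], where [z ⊣ u] lies in [Z_{j-i}] because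
    multiplying by an element of [L^i] lowers the upper central series by [i]
    steps ([ucs_lcs]).  Strong induction on [j] finishes.

    For [L] nilpotent of class [n], taking [j = n - 1] shows that the restriction
    of a cocycle to [L × L^n] and [L^n × L] factors through [L/Z_{n-1}], which
    gives a linear map on [Z^2(L, F)] ([pairing]).  It kills coboundaries, since
    [ε] is then evaluated on products lying in [L^{n+1} = 0], so it induces
    [δ] on [H^2(L, F)].

    Exactness: an inflated cocycle vanishes as soon as one argument is in [L^n],
    so [δ ∘ Inf = 0].  Conversely, a cocycle whose class is killed by [δ]
    vanishes on [L × L^n] and [L^n × L], hence descends to a cocycle on
    [L/L^n] of which it is the inflation ([infl_descent]). *)

Set Implicit Arguments.
Unset Strict Implicit.
Unset Printing Implicit Defensive.

Import GRing.Theory.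
Local Open Scope ring_scope.
Local Open Scope classical_set_scope.

(** * Linear and bilinear maps on quotients *)

Lemma qproj_repr (F : fieldType) (V : lmodType F) (U : subspace V)
  (q : quot_space U) : qproj U (repr q) = q.
Proof. by rewrite /qproj reprK. Qed.

(** A linear map that vanishes on [U] factors through the quotient by [U]. *)
Lemma quot_lift (F : fieldType) (V W : lmodType F) (U : subspace V)
    (g : {linear V -> W}) :
  (forall x, subspace_set U x -> g x = 0) ->
  exists h : {linear quot_space U -> W}, forall x, h (qproj U x) = g x.
Proof.
move=> gU; pose h (q : quot_space U) := g (repr q).
have hE x : h (qproj U x) = g x.
  apply/eqP; rewrite -subr_eq0 -raddfB; apply/eqP/gU/qproj_eq.
  exact: qproj_repr.
have hlin : linear h.
  move=> a p q; rewrite -(qproj_repr p) -(qproj_repr q).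
  by rewrite -(linearP (qproj U)) !hE linearP.
pose h' : {linear quot_space U -> W} :=
  HB.pack h (GRing.isLinear.Build F (quot_space U) W _ h hlin).
by exists h'.
Qed.

Section BilinearForms.
Variables (F : fieldType) (X Y : lmodType F).
Implicit Type f : bilform X Y.

Lemma bilformPl f a x x' y : f (a *: x + x') y = a * f x y + f x' y.
Proof. by have [fl _] := bilformP f; exact: fl. Qed.

Lemma bilformPr f a x y y' : f x (a *: y + y') = a * f x y + f x y'.
Proof. by have [_ fr] := bilformP f; exact: fr. Qed.

Lemma bilform0l f y : f 0 y = 0.
Proof. by have := bilformPl f (-1) 0 0 y; rewrite scaler0 addr0 mulN1r addNr. Qed.

Lemma bilform0r f x : f x 0 = 0.
Proof. by have := bilformPr f (-1) x 0 0; rewrite scaler0 addr0 mulN1r addNr. Qed.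

Lemma bilformBl f x x' y : f (x - x') y = f x y - f x' y.
Proof. by rewrite addrC -scaleN1r bilformPl mulN1r addrC. Qed.

Lemma bilformBr f x y y' : f x (y - y') = f x y - f x y'.
Proof. by rewrite addrC -scaleN1r bilformPr mulN1r addrC. Qed.

Let flip_bilinear f : bilinear_for *%R *%R (fun y x => f x y).
Proof.
by split=> u k x y; [exact: bilformPr|exact: bilformPl].
Qed.

(** The form with its two arguments exchanged. *)
Definition flip_bilform f : bilform Y X := Bilform (flip_bilinear f).

End BilinearForms.

Section QuotientForms.
Variables (F : fieldType) (V : lmodType F) (U W : subspace V).

Section LeftQuotient.
Variable f : bilform V V.
Hypothesis fUW : forall u w, subspace_set U u -> subspace_set W w -> f u w = 0.

Let g (q : quot_space U) (b : sub_space W) : F := f (repr q) (val b).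

Let gE x b : g (qproj U x) b = f x (val b).
Proof.
apply/eqP; rewrite -subr_eq0 -bilformBl; apply/eqP/fUW.
  by apply/qproj_eq; exact: qproj_repr.
by apply/subspace_predP; exact: valP.
Qed.

Let g_bilinear : bilinear_for *%R *%R g.
Proof.
split=> u k x y /=.
  rewrite -(qproj_repr x) -(qproj_repr y) -(linearP (qproj U)) !gE.
  exact: bilformPl.
by rewrite /g linearP bilformPr.
Qed.

(** The form on [V/U × W] induced by a form on [V] that vanishes on [U × W]. *)
Definition quot_sub_form : bilform (quot_space U) (sub_space W) :=
  Bilform g_bilinear.

Lemma quot_sub_formE x b : quot_sub_form (qproj U x) b = f x (val b).
Proof. exact: gE. Qed.

End LeftQuotient.

Section BothQuotients.
Variable f : bilform V V.
Hypothesis fUl : forall u x, subspace_set U u -> f u x = 0.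
Hypothesis fUr : forall u x, subspace_set U u -> f x u = 0.

Let g (p q : quot_space U) : F := f (repr p) (repr q).

Let gE x y : g (qproj U x) (qproj U y) = f x y.
Proof.
have Urepr z : subspace_set U (repr (qproj U z) - z).
  by apply/qproj_eq; exact: qproj_repr.
transitivity (f x (repr (qproj U y))); apply/eqP.
  by rewrite -subr_eq0 -bilformBl fUl.
by rewrite -subr_eq0 -bilformBr fUr.
Qed.

Let g_bilinear : bilinear_for *%R *%R g.
Proof.
split=> u k x y /=; rewrite -(qproj_repr x) -(qproj_repr y) -(qproj_repr u);
  rewrite -(linearP (qproj U)) !gE; [exact: bilformPl|exact: bilformPr].
Qed.

(** The form on [V/U] induced by a form on [V] with [U] in both radicals. *)
Definition quot_form : bilform (quot_space U) (quot_space U) :=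
  Bilform g_bilinear.

Lemma quot_formE x y : quot_form (qproj U x) (qproj U y) = f x y.
Proof. exact: gE. Qed.

End BothQuotients.
End QuotientForms.

(** * The two central series and cocycles *)

Section CentralSeries.
Variables (F : fieldType) (L : diassType F).
Implicit Types (u v z : L) (P : set L).

Lemma is_subspace0 P : is_subspace P -> P 0.
Proof. by case. Qed.

Lemma is_subspaceP P a x y : is_subspace P -> P x -> P y -> P (a *: x + y).
Proof. by case=> _; exact. Qed.

Lemma dil_linearl a x y z : (a *: x + y) ⊣ z = a *: (x ⊣ z) + y ⊣ z.
Proof. by have [h _] := @dil_bilinear F L; exact: h. Qed.

Lemma dil_linearr a x y z : z ⊣ (a *: x + y) = a *: (z ⊣ x) + z ⊣ y.
Proof. by have [_ h] := @dil_bilinear F L; exact: h. Qed.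

Lemma dir_linearl a x y z : (a *: x + y) ⊢ z = a *: (x ⊢ z) + y ⊢ z.
Proof. by have [h _] := @dir_bilinear F L; exact: h. Qed.

Lemma dir_linearr a x y z : z ⊢ (a *: x + y) = a *: (z ⊢ x) + z ⊢ y.
Proof. by have [_ h] := @dir_bilinear F L; exact: h. Qed.

Lemma dil0l x : (0 : L) ⊣ x = 0.
Proof. by have := dil_linearl (-1) 0 0 x; rewrite scaler0 addr0 scaleN1r addNr. Qed.

Lemma dil0r x : x ⊣ (0 : L) = 0.
Proof. by have := dil_linearr (-1) 0 0 x; rewrite scaler0 addr0 scaleN1r addNr. Qed.

Lemma dir0l x : (0 : L) ⊢ x = 0.
Proof. by have := dir_linearl (-1) 0 0 x; rewrite scaler0 addr0 scaleN1r addNr. Qed.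

Lemma dir0r x : x ⊢ (0 : L) = 0.
Proof. by have := dir_linearr (-1) 0 0 x; rewrite scaler0 addr0 scaleN1r addNr. Qed.

Lemma lozenge_ind (X Y P : set L) : is_subspace P ->
  (forall u v, X u -> Y v -> P (u ⊣ v) /\ P (u ⊢ v)) -> lozenge X Y `<=` P.
Proof.
move=> sP XYP _ [x Xx [y Yy <-]]; rewrite -[x]scale1r.
apply: is_subspaceP => //.
- by apply: Xx; split=> // _ [u Xu [v Yv <-]]; case: (XYP u v).
- by apply: Yy; split=> // _ [u Xu [v Yv <-]]; case: (XYP u v).
Qed.

(** The products [u ⊣ v] and [u ⊢ v] with [u] in [L^{i+1}], [v] in [L^{j+1}] and
    [i + j = k] span [L^{k+2}]. *)
Lemma lcs_ind k P : is_subspace P ->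
  (forall i j u v, (i + j = k)%N -> lcs i.+1 u -> lcs j.+1 v ->
     P (u ⊣ v) /\ P (u ⊢ v)) -> lcs k.+2 `<=` P.
Proof.
move=> sP prodP; rewrite lcsS big_nat.
elim/big_ind: _ => [_ ->|A B AP BP _ [x Ax [y By <-]]|[//|i] /andP[_ ik]].
- exact: is_subspace0.
- by rewrite -[x]scale1r; apply: is_subspaceP => //; [exact: AP|exact: BP].
- apply: lozenge_ind => // u v; rewrite subSS subSn // => iu jv.
  by apply: (prodP i (k - i)%N) => //; rewrite subnKC.
Qed.

Lemma lcs_mul i j u v : lcs i.+1 u -> lcs j.+1 v ->
  lcs (i + j).+2 (u ⊣ v) /\ lcs (i + j).+2 (u ⊢ v).
Proof.
have loz := @lozenge_lcs F L i.+1 j.+1 isT isT.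
rewrite addSn addnS in loz => iu jv; split; apply: loz.
- exists (u ⊣ v); first by apply: sub_gen_smallest; exists u => //; exists v.
  by exists 0; [exact: (lin_span_subspace _).1|rewrite addr0].
- exists 0; first exact: (lin_span_subspace _).1.
  by exists (u ⊢ v); [apply: sub_gen_smallest; exists u => //; exists v|rewrite add0r].
Qed.

(** [Z_{i+j}] multiplied on either side by [L^i], with [i >= 1], lands in [Z_j]; in the
    statement, [i] is shifted by one. *)
Lemma ucs_lcs i j u z : lcs i.+1 u -> ucs (i.+1 + j) z ->
  [/\ @ucs F L j (z ⊣ u), ucs j (z ⊢ u), ucs j (u ⊣ z) & ucs j (u ⊢ z)].
Proof.
elim/ltn_ind: i j u z => -[_ j u z _|k IHk j u z ku zj].
  by rewrite add1n ucsS => /(_ u).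
have sZ := ucs_is_subspace L j.
move: u ku; apply: lcs_ind.
  split=> [|a x y [x1 x2 x3 x4] [y1 y2 y3 y4]].
    by rewrite /= dil0l dil0r dir0l dir0r; split; exact: is_subspace0.
  rewrite /= dil_linearl dil_linearr dir_linearl dir_linearr.
  by split; exact: is_subspaceP.
move=> a b u v abk au bv.
have ak : (a < k.+1)%N by rewrite ltnS -abk leq_addr.
have bk : (b < k.+1)%N by rewrite ltnS -abk leq_addl.
have zab : ucs (a.+1 + (b.+1 + j)) z.
  by move: zj; rewrite -abk !addSn !addnS addnA.
have zba : ucs (b.+1 + (a.+1 + j)) z.
  by move: zab; rewrite !addSn !addnS addnCA.
have [zu1 zu2 _ _] := IHk a ak _ _ _ au zab.
have [_ _ vz1 vz2] := IHk b bk _ _ _ bv zba.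
have [zuv1 _ _ _] := IHk b bk _ _ _ bv zu1.
have [zuv2 zuv3 _ _] := IHk b bk _ _ _ bv zu2.
have [_ _ uvz1 uvz2] := IHk a ak _ _ _ au vz1.
have [_ _ _ uvz3] := IHk a ak _ _ _ au vz2.
split; split.
- by rewrite dilA.
- by rewrite -dil_dir.
- by rewrite -dilA.
- by rewrite dir_dirl -dirA.
- by rewrite -dil_dilr dilA.
- by rewrite dirA.
- by rewrite dil_dir.
- by rewrite -dirA.
Qed.

(** [f(Z_j, L^{j+1}) = f(L^{j+1}, Z_j) = 0] for every cocycle [f]. *)
Lemma cocycle_ucs_lcs (f : cochain L) j z b : is_cocycle f ->
  ucs j z -> lcs j.+1 b ->
  [/\ f.1 z b = 0, f.2 z b = 0, f.1 b z = 0 & f.2 b z = 0].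
Proof.
move=> fc; elim/ltn_ind: j z b => -[_ z b -> _|k IHk z b zk].
  by rewrite !bilform0l !bilform0r.
move: b; apply: lcs_ind.
  split=> [|a x y [x1 x2 x3 x4] [y1 y2 y3 y4]].
    by rewrite /= !bilform0l !bilform0r.
  by rewrite /= !bilformPl !bilformPr x1 x2 x3 x4 y1 y2 y3 y4 mulr0 addr0.
move=> i j u v ijk iu jv.
have ik : (i < k.+1)%N by rewrite ltnS -ijk leq_addr.
have jk : (j < k.+1)%N by rewrite ltnS -ijk leq_addl.
have zij : ucs (i.+1 + j) z by rewrite addSn ijk.
have zji : ucs (j.+1 + i) z by rewrite addSn addnC ijk.
have [zu1 zu2 _ _] := ucs_lcs iu zij.
have [_ _ vz1 vz2] := ucs_lcs jv zji.
have [zuv1 _ _ _] := IHk j jk _ _ zu1 jv.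
have [zuv2 zuv3 _ _] := IHk j jk _ _ zu2 jv.
have [_ _ uvz1 uvz2] := IHk i ik _ _ vz1 iu.
have [_ _ _ uvz3] := IHk i ik _ _ vz2 iu.
have [l1 l2 l3 l4 l5] := fc z u v; have [r1 r2 r3 r4 r5] := fc u v z.
split; split.
- by rewrite l4.
- by rewrite -l2.
- by rewrite -r4.
- by rewrite r3 -r5.
- by rewrite -l1 l4.
- by rewrite l5.
- by rewrite r2.
- by rewrite -r5.
Qed.

End CentralSeries.

(** * Restricting a cocycle to the last term of the lower central series *)

Section Pairing.
Variables (F : fieldType) (L : diassType F) (n : nat).
Hypothesis n_gt0 : (0 < n)%N.

Local Notation U := (ucs_subspace L n.-1).
Local Notation W := (lcs_ideal L n).

Let vanish (z : Z2 L) u w : subspace_set U u -> subspace_set W w ->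
  [/\ (cocycle z).1 u w = 0, (cocycle z).2 u w = 0,
      (cocycle z).1 w u = 0 & (cocycle z).2 w u = 0].
Proof.
move=> Uu Ww; apply: cocycle_ucs_lcs Uu _; first exact: cocycleP.
by rewrite prednK.
Qed.

Let vanish1l z u w : subspace_set U u -> subspace_set W w ->
  (cocycle z).1 u w = 0.
Proof. by move=> Uu Ww; case: (vanish z Uu Ww). Qed.

Let vanish2l z u w : subspace_set U u -> subspace_set W w ->
  (cocycle z).2 u w = 0.
Proof. by move=> Uu Ww; case: (vanish z Uu Ww). Qed.

Let vanish1r z u w : subspace_set U u -> subspace_set W w ->
  flip_bilform (cocycle z).1 u w = 0.
Proof. by move=> Uu Ww; case: (vanish z Uu Ww). Qed.

Let vanish2r z u w : subspace_set U u -> subspace_set W w ->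
  flip_bilform (cocycle z).2 u w = 0.
Proof. by move=> Uu Ww; case: (vanish z Uu Ww). Qed.

(** The map [δ] at the level of cocycles. *)
Definition pairing (z : Z2 L) : bilform_quad (quot_space U) (sub_space W) :=
  ((quot_sub_form (vanish1l z), flip_bilform (quot_sub_form (vanish1r z))),
   (quot_sub_form (vanish2l z), flip_bilform (quot_sub_form (vanish2r z)))).

Lemma pairingE z x (b : sub_space W) :
  [/\ (pairing z).1.1 (qproj U x) b = (cocycle z).1 x (val b),
      (pairing z).1.2 b (qproj U x) = (cocycle z).1 (val b) x,
      (pairing z).2.1 (qproj U x) b = (cocycle z).2 x (val b) &
      (pairing z).2.2 b (qproj U x) = (cocycle z).2 (val b) x].
Proof.
by split; [exact: quot_sub_formE|exact: (quot_sub_formE (vanish1r z))|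
           exact: quot_sub_formE|exact: (quot_sub_formE (vanish2r z))].
Qed.

Lemma bilform_quad_ext (X Y : lmodType F) (p q : bilform_quad X Y) :
  (forall x y, [/\ p.1.1 x y = q.1.1 x y, p.1.2 y x = q.1.2 y x,
                   p.2.1 x y = q.2.1 x y & p.2.2 y x = q.2.2 y x]) -> p = q.
Proof.
move: p q => [[p1 p2] [p3 p4]] [[q1 q2] [q3 q4]] /= pq.
by congr ((_, _), (_, _)); apply: bilform_ext => x y;
  [case: (pq x y)|case: (pq y x)|case: (pq x y)|case: (pq y x)].
Qed.

Lemma pairing_linear : linear pairing.
Proof.
move=> a y z; apply: bilform_quad_ext => q b; rewrite -(qproj_repr q).
set x := repr q.
have [-> -> -> ->] := pairingE (a *: y + z) x b.
have [y1 y2 y3 y4] := pairingE y x b; have [z1 z2 z3 z4] := pairingE z x b.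
rewrite cocycle_linear; split; rewrite [LHS]bilformE [RHS]bilformE.
- by rewrite y1 z1.
- by rewrite y2 z2.
- by rewrite y3 z3.
- by rewrite y4 z4.
Qed.

HB.instance Definition _ := GRing.isLinear.Build F (Z2 L)
  (bilform_quad (quot_space U) (sub_space W)) _ pairing pairing_linear.

Lemma pairing_eq0 z :
  pairing z = 0 <->
  forall x w, lcs n w -> [/\ (cocycle z).1 x w = 0, (cocycle z).1 w x = 0,
                             (cocycle z).2 x w = 0 & (cocycle z).2 w x = 0].
Proof.
split=> [z0 x w Ww|z0].
  pose b : sub_space W := exist _ w (introT (subspace_predP W w) Ww).
  by have [<- <- <- <-] := pairingE z x b; rewrite z0.
apply: bilform_quad_ext => q b; rewrite -(qproj_repr q).
have [-> -> -> ->] := pairingE z (repr q) b.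
by apply: z0; apply/(subspace_predP W); exact: valP.
Qed.

(** The products of [x] in [L] with [w] in [L^n] lie in [L^{n+1} = 0], so [ε] vanishes
    on them. *)
Lemma pairing_coboundary z :
  lcs n.+1 = [set 0 : L] -> is_coboundary (cocycle z) -> pairing z = 0.
Proof.
move=> Ln0 [e ez]; apply/pairing_eq0 => x w.
rewrite -(prednK n_gt0) in Ln0 * => Ww.
have [] := lcs_mul (i := 0) (u := x) I Ww.
have [] := lcs_mul (j := 0) (v := x) Ww I.
rewrite addn0 add0n Ln0 => wx1 wx2 xw1 xw2.
rewrite !(ez _ _).1 !(ez _ _).2.
by rewrite (wx1 : _ = 0) (wx2 : _ = 0) (xw1 : _ = 0) (xw2 : _ = 0) linear0 oppr0.
Qed.

End Pairing.

(** * Cocycles that are inflated from a quotient *)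

Section Descent.
Variables (F : fieldType) (L : diassType F) (I : ideal L).

Lemma infl_ideal_eq0 (z : Z2 (quot_alg I)) x w : subspace_set I w ->
  [/\ (cocycle (infl z)).1 x w = 0, (cocycle (infl z)).1 w x = 0,
      (cocycle (infl z)).2 x w = 0 & (cocycle (infl z)).2 w x = 0].
Proof.
move=> Iw; have w0 : qalg I w = 0.
  rewrite -(linear0 (qalg I)); by apply/qproj_eq; rewrite subr0.
rewrite !(inflE _ _ _).1 !(inflE _ _ _).2 w0.
by rewrite !bilform0l !bilform0r.
Qed.

(** A cocycle that vanishes as soon as one argument is in [I] is, on the nose and not
    only up to a coboundary, inflated from [L/I]. *)
Lemma infl_descent (z : Z2 L) :
  (forall x w, subspace_set I w ->
     [/\ (cocycle z).1 x w = 0, (cocycle z).1 w x = 0,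
         (cocycle z).2 x w = 0 & (cocycle z).2 w x = 0]) ->
  exists y : Z2 (quot_alg I), infl y = z.
Proof.
move=> z0.
have z1l w x : subspace_set I w -> (cocycle z).1 w x = 0 by case/(z0 x).
have z1r w x : subspace_set I w -> (cocycle z).1 x w = 0 by case/(z0 x).
have z2l w x : subspace_set I w -> (cocycle z).2 w x = 0 by case/(z0 x).
have z2r w x : subspace_set I w -> (cocycle z).2 x w = 0 by case/(z0 x).
pose f : cochain (quot_alg I) := (quot_form z1l z1r, quot_form z2l z2r).
have f1E x y : f.1 (qalg I x) (qalg I y) = (cocycle z).1 x y.
  exact: (quot_formE z1l z1r).
have f2E x y : f.2 (qalg I x) (qalg I y) = (cocycle z).2 x y.
  exact: (quot_formE z2l z2r).
have fc : is_cocycle f.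
  move=> p q r; have [{p}i ->] : exists x, p = qalg I x by exact: qproj_surj.
  have [{q}j ->] : exists x, q = qalg I x by exact: qproj_surj.
  have [{r}k ->] : exists x, r = qalg I x by exact: qproj_surj.
  by rewrite -!qalg_dil -!qalg_dir !f1E !f2E; exact: cocycleP.
exists (Cocycle fc); apply: val_inj; rewrite -!/(cocycle _).
rewrite [RHS]surjective_pairing [LHS]surjective_pairing.
by congr (_, _); apply: bilform_ext => x y;
  [rewrite (inflE _ _ _).1 f1E|rewrite (inflE _ _ _).2 f2E].
Qed.

End Descent.

(** * Exactness *)

Theorem theorem4p3 (F : fieldType) (L : diassType F) (n : nat)
    (hL : nilpotent_of_class L n) :
  exists delta : {linear H2 L -> bilform_quad (quot_space (ucs_subspace L n.-1))
                                              (sub_space (lcs_ideal L n))},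
    (forall (z : Z2 L) (x : L) (b : sub_space (lcs_ideal L n)),
       let: ((f1, g1), (f2, g2)) := delta (cohom_class z) in
       [/\ f1 (qproj (ucs_subspace L n.-1) x) b = (cocycle z).1 x (val b),
           g1 b (qproj (ucs_subspace L n.-1) x) = (cocycle z).1 (val b) x,
           f2 (qproj (ucs_subspace L n.-1) x) b = (cocycle z).2 x (val b) &
           g2 b (qproj (ucs_subspace L n.-1) x) = (cocycle z).2 (val b) x]) /\
    (forall h : H2 L,
       delta h = 0 <-> exists h0 : H2 (quot_alg (lcs_ideal L n)), Inf h0 = h).
Proof.
have [n_gt0 _ Ln0] := hL.
have [delta deltaE] := @quot_lift F (Z2 L) _ (B2_subspace L) (pairing n_gt0)
  (fun z => pairing_coboundary n_gt0 Ln0).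
exists delta; split=> [z x b|h].
  by rewrite deltaE; exact: pairingE.
have [z ->] := qproj_surj h; rewrite deltaE.
split=> [/pairing_eq0 z0|[h0]].
  have [y <-] := @infl_descent F L (lcs_ideal L n) z z0.
  by exists (cohom_class y); rewrite Inf_cohom_class.
have [y ->] := qproj_surj h0.
rewrite -/(cohom_class y) Inf_cohom_class -deltaE => <-; rewrite deltaE.
by apply/pairing_eq0 => x w; exact: (infl_ideal_eq0 (I := lcs_ideal L n)).
Qed.
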